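(* Let $\mu_m=\dfrac{(aq;q)_m}{(abq^2;q)_m}$ for integers $m\ge 0$. Let $n$ be a positive integer and let $k_0,\dots,k_{n-1}$ be nonnegative integers. Then $$\det\left(\mu_{k_i+j}\right)_{0\le i,j\le n-1}=a^{\binom n2}\,q^{\binom{n+1}3}\prod_{i=0}^{n-1}\frac{(aq;q)_{k_i}}{(abq^2;q)_{k_i+n-1}}\prod_{0\le i<j\le n-1}\left(q^{k_i}-q^{k_j}\right)\prod_{i=0}^{n-1}(bq;q)_i.$$
   Context: Here $a,b,q$ are indeterminates, and the identity is an identity of rational functions in $a,b,q$. For a nonnegative integer $m$, the $q$-shifted factorial is $(x;q)_m=\prod_{k=0}^{m-1}(1-xq^k)$, with $(x;q)_0=1$. *)

(* Defs.v *)
From HB Require Import structures.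
From mathcomp Require Import all_boot all_order all_algebra.
From mathcomp Require Import mpoly.

Set Implicit Arguments.
Unset Strict Implicit.
Unset Printing Implicit Defensive.

Import GRing.Theory.
Local Open Scope ring_scope.

Definition qpoch (R : comNzRingType) (x q : R) (m : nat) : R :=
  \prod_(k < m) (1 - x * q ^+ k).

(* The field K(a, b, q).  The field K of constants is left arbitrary, so that
   the usual choices (rationals, complex numbers) are instances.  *)
Definition ratfun (K : fieldType) := {fraction {mpoly K[3]}}.

Definition ind_a (K : fieldType) : ratfun K := tofrac 'X_(@Ordinal 3 0 isT).
Definition ind_b (K : fieldType) : ratfun K := tofrac 'X_(@Ordinal 3 1 isT).
Definition ind_q (K : fieldType) : ratfun K := tofrac 'X_(@Ordinal 3 2 isT).

Definition mu (F : fieldType) (a b q : F) (m : nat) : F :=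
  qpoch (a * q) q m / qpoch (a * b * q ^+ 2) q m.

(* Main.v *)
(** Factoring [(aq;q)_k / (abq^2;q)_(k+n-1)] out of each row leaves the matrix of
    values at [x_i = q^(k_i)] of the polynomials
    [P_j(x) = (aqx;q)_j (abq^(j+2)x;q)_(n-1-j)]. Its determinant is a Vandermonde
    determinant times the determinant of the coefficients of the [P_j]. More
    generally take [P_j = prod_(l<j) (1+u_l y) prod_(j<=l<n-1) (1+v_l y)]:
    then [P_j - P_(j+1)] is [(v_j - u_j) y] times the analogous polynomial of the
    family with [n-1] in place of [n] and [v] shifted, so the coefficient
    determinant is computed by induction. *)
Require Import Defs.
From HB Require Import structures.
From mathcomp Require Import all_boot all_order all_algebra.
From mathcomp Require Import mpoly ring.

Set Implicit Arguments.
Unset Strict Implicit.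
Unset Printing Implicit Defensive.

Import GRing.Theory.
Local Open Scope ring_scope.

Lemma qpochD (R : comNzRingType) (x q : R) (m n : nat) :
  qpoch x q (m + n) = qpoch x q m * qpoch (x * q ^+ m) q n.
Proof.
rewrite /qpoch big_split_ord /=; congr (_ * _).
by apply: eq_bigr => i _; rewrite exprD mulrA.
Qed.

Section MixedProducts.
Variable R : comNzRingType.
Implicit Types u v : nat -> R.

(** [n] counts the factors, so [j] ranges over [0..n], and the [v] factors keep their absolute
    index, from [j] to [n - 1]. *)
Definition mixed_prod n u v j : {poly R} :=
  (\prod_(l < j) (1 + u l *: 'X)) * \prod_(l < n - j) (1 + v (j + l)%N *: 'X).

Lemma size_prod_affine m (w : nat -> R) :
  (size (\prod_(l < m) (1 + w l *: 'X : {poly R}))%R <= m.+1)%N.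
Proof.
elim: m => [|m IH]; first by rewrite big_ord0 size_poly1.
rewrite big_ord_recr /= mulrDr mulr1 -scalerAr.
apply: leq_trans (size_polyD _ _) _; rewrite geq_max (leq_trans IH) //=.
apply: leq_trans (size_scale_leq _ _) _; apply: leq_trans (size_polyMleq _ _) _.
by rewrite size_polyX addn2 /= ltnS.
Qed.

Lemma size_mixed_prod n u v j :
  (j <= n)%N -> (size (mixed_prod n u v j) <= n.+1)%N.
Proof.
move=> le_jn; apply: leq_trans (size_polyMleq _ _) _.
have := leq_add (size_prod_affine j u)
                (size_prod_affine (n - j) (fun l => v (j + l)%N)).
by rewrite addSn addnS subnKC //; case: (_ + _)%N.
Qed.

(** The two products differ in a single factor, with coefficient [v j] against [u j]; the common
    factors skip [v j], hence the shift of [v]. *)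
Lemma mixed_prod_diff n u v j : (j <= n)%N ->
  mixed_prod n.+1 u v j - mixed_prod n.+1 u v j.+1 =
  (v j - u j) *: (mixed_prod n u (v \o succn) j * 'X).
Proof.
move=> le_jn; rewrite /mixed_prod subSS subSn // big_ord_recl big_ord_recr /=.
rewrite addn0.
have -> : \prod_(l < n - j) (1 + v (j + bump 0 l)%N *: 'X) =
          \prod_(l < n - j) (1 + v (j.+1 + l)%N *: 'X) :> {poly R}.
  by apply: eq_bigr => l _; rewrite /bump /= add1n addnS.
rewrite (eq_bigr (fun l : 'I_(n - j) => 1 + v (j + l).+1 *: 'X)) //.
by rewrite -!mul_polyC polyCB; ring.
Qed.

Lemma mixed_prod0 n u v j : (mixed_prod n u v j)`_0 = 1.
Proof.
rewrite -horner_coef0 /mixed_prod hornerM !horner_prod.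
by rewrite !big1 ?mulr1 // => l _; rewrite !hornerE ?mulr0 ?addr0.
Qed.

(** After subtracting from each row the next one, column 0 is zero except for a final 1. Its
    cofactor yields the diagonal [d = 0]; the shift of [v] accounts for the later diagonals. *)
Lemma det_mixed_prod_coef n u v :
  \det (\matrix_(i < n.+1, j < n.+1) (mixed_prod n u v i)`_j) =
  \prod_(d < n) \prod_(l < n - d) (u l - v (l + d)%N).
Proof.
elim: n v => [|n IH] v.
  by rewrite det_mx11 mxE mixed_prod0 big_ord0.
set M := \matrix_(i, j) _.
(* Left multiplication by this unitriangular matrix performs the row subtractions and keeps the last
   row. *)
pose E : 'M[R]_n.+2 := \matrix_(i, j) ((i == j)%:R - (i.+1 == j)%:R).
have detE : \det E = 1.
  rewrite -det_tr det_trig; last first.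
    apply/is_trig_mxP => i j lt_ij; rewrite !mxE -val_eqE /=.
    by rewrite (gtn_eqF lt_ij) (gtn_eqF (leqW lt_ij)) subr0.
  by apply: big1 => i _; rewrite !mxE eqxx (gtn_eqF (leqnn _)) subr0.
have EME i j : (E *m M) i j =
    if (i < n.+1)%N
    then (v i - u i) * (mixed_prod n u (v \o succn) i * 'X)`_j
    else (mixed_prod n.+1 u v i)`_j.
  rewrite mxE.
  under eq_bigr => k _ do rewrite !mxE mulrBl.
  rewrite sumrB (bigD1 i) //= eqxx mul1r big1 ?addr0; last first.
    by move=> k /negPf ne_ki; rewrite eq_sym ne_ki mul0r.
  case: ifP => lt_in.
    rewrite (bigD1 (Ordinal (lt_in : (i.+1 < n.+2)%N))) //= eqxx mul1r.
    rewrite big1 ?addr0; last first.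
      by move=> k; rewrite -val_eqE eq_sym => /= /negPf ->; rewrite mul0r.
    by rewrite -coefB mixed_prod_diff // coefZ.
  rewrite big1 ?subr0 // => k _.
  by rewrite (gtn_eqF (leq_trans (ltn_ord k) _)) ?mul0r // ltnS leqNgt lt_in.
have -> : \det M = \det (E *m M) by rewrite det_mulmx detE mul1r.
rewrite (expand_det_col _ ord0) (bigD1 ord_max) //= big1 ?addr0; last first.
  move=> i ne_i; rewrite EME ifT ?coefMX ?mulr0 ?mul0r //.
  by rewrite ltn_neqAle -ltnS ltn_ord andbT; apply: contraNneq ne_i => e;
     apply/eqP/val_inj.
rewrite EME /= ltnn mixed_prod0 mul1r /cofactor addn0.
have -> : row' ord_max (col' ord0 (E *m M)) =
    diag_mx (\row_(j < n.+1) (v j - u j)) *m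
      \matrix_(i < n.+1, j < n.+1) (mixed_prod n u (v \o succn) i)`_j.
  apply/matrixP => i j; rewrite mul_diag_mx !mxE.
  have := EME (lift ord_max i) (lift ord0 j); rewrite mxE lift_max => ->.
  by rewrite ltn_ord coefMX lift0.
rewrite det_mulmx IH det_diag mulrA [in RHS]big_ord_recl /= subn0; congr (_ * _).
  (* The cofactor sign, spread over the [n.+1] factors, turns [v j - u j] into [u j - v j]. *)
  rewrite -[X in (-1) ^+ X](card_ord n.+1) -prodrN.
  by apply: eq_bigr => i _; rewrite mxE opprB addn0.
apply: eq_bigr => d _; rewrite /bump /= add1n subSS.
by apply: eq_bigr => l _; rewrite addnS.
Qed.

Lemma det_mixed_prod_eval n u v (x : 'I_n.+1 -> R) :
  \det (\matrix_(i < n.+1, j < n.+1) (mixed_prod n u v j).[x i]) =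
  (\prod_(d < n) \prod_(l < n - d) (u l - v (l + d)%N)) *
  \prod_(i < n.+1) \prod_(j < n.+1 | (i < j)%N) (x j - x i).
Proof.
rewrite -det_mixed_prod_coef -det_tr.
have -> : (\matrix_(i < n.+1, j < n.+1) (mixed_prod n u v j).[x i])^T =
    (\matrix_(i < n.+1, j < n.+1) (mixed_prod n u v i)`_j) *m
    Vandermonde n.+1 (\row_i x i).
  apply/matrixP => i j; rewrite !mxE.
  rewrite (horner_coef_wide _ (size_mixed_prod u v _)) -1?ltnS //.
  by apply: eq_bigr => k _; rewrite !mxE.
rewrite det_mulmx det_Vandermonde; congr (_ * _).
by apply: eq_bigr => i _; apply: eq_bigr => j _; rewrite !mxE.
Qed.

(* The double product is taken over the diagonals [d = m - l] of the triangle
   [l <= m < n]; the step from [n] to [n.+1] adds the row [m = n]. *)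
Lemma prod_triangle_qpoch n (a b q : R) :
  \prod_(d < n) \prod_(l < n - d)
     (a * q * q ^+ l - a * b * q ^+ 2 * q ^+ (l + d)) =
  a ^+ 'C(n.+1, 2) * q ^+ 'C(n.+2, 3) * \prod_(i < n.+1) qpoch (b * q) q i.
Proof.
elim: n => [|n IH].
  by rewrite big_ord0 big_ord_recl big_ord0 /qpoch big_ord0 !expr0 !mulr1.
pose f l d := a * q * q ^+ l - a * b * q ^+ 2 * q ^+ (l + d).
(* Each old diagonal gains the entry [l = n - d]; the new diagonal [d = n] is that entry alone. *)
have -> : \prod_(d < n.+1) \prod_(l < n.+1 - d) f l d =
    (\prod_(d < n) \prod_(l < n - d) f l d) * \prod_(d < n.+1) f (n - d)%N d.
  under eq_bigr => d _ do rewrite subSn -1?ltnS // big_ord_recr /=.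
  rewrite big_split /=; congr (_ * _).
  by rewrite big_ord_recr /= subnn big_ord0 mulr1.
have -> : \prod_(i < n.+2) qpoch (b * q) q i =
    (\prod_(i < n.+1) qpoch (b * q) q i) * qpoch (b * q) q n.+1.
  by rewrite big_ord_recr.
rewrite IH (binS n.+1 1) (binS n.+2 2) bin1.
rewrite (exprD a 'C(n.+1, 2)) (exprD q 'C(n.+2, 3)).
have -> : \prod_(d < n.+1) f (n - d)%N d =
    a ^+ n.+1 * q ^+ 'C(n.+2, 2) * qpoch (b * q) q n.+1.
  (* [f (n - d) d] equals [a * q ^+ (n - d).+1 * (1 - b * q * q ^+ d)], and the exponents
     [(n - d).+1] sum to ['C(n.+2, 2)]. *)
  have -> : a ^+ n.+1 * q ^+ 'C(n.+2, 2) =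
            \prod_(d < n.+1) (a * q ^+ (n - d).+1).
    rewrite big_split /= prodr_const card_ord; congr (_ * _).
    rewrite -expr_sum -bin2_sum big_mkord big_ord_recl add0n; congr (_ ^+ _).
    rewrite [RHS](reindex_inj rev_ord_inj) /=.
    by apply: eq_bigr => i _; rewrite /bump /= add1n subSS subKn // -ltnS.
  rewrite /qpoch -big_split /=; apply: eq_bigr => d _.
  by rewrite /f (exprD q (n - d)) (exprS q (n - d)); ring.
by ring.
Qed.

End MixedProducts.

(** The identity holds in any field once the denominators are nonzero; indeterminates serve only to
    ensure that. *)
Lemma det_mu (F : fieldType) (a b q : F) (n : nat) (k : 'I_n.+1 -> nat) :
  (forall m, qpoch (a * b * q ^+ 2) q m != 0) ->
  \det (\matrix_(i < n.+1, j < n.+1) mu a b q (k i + j)%N) =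
    a ^+ 'C(n.+1, 2) * q ^+ 'C(n.+2, 3)
    * (\prod_(i < n.+1) (qpoch (a * q) q (k i)
                         / qpoch (a * b * q ^+ 2) q (k i + n)%N))
    * (\prod_(i < n.+1) \prod_(j < n.+1 | (i < j)%N) (q ^+ k i - q ^+ k j))
    * (\prod_(i < n.+1) qpoch (b * q) q i).
Proof.
move=> nz.
pose u l := a * q * q ^+ l; pose v l := a * b * q ^+ 2 * q ^+ l.
pose c := \row_i (qpoch (a * q) q (k i) / qpoch (a * b * q ^+ 2) q (k i + n)%N).
(* Evaluating at [- q ^+ k i] turns the factors [1 + w l *: 'X] into q-factorial factors and gives
   the Vandermonde differences the stated sign. *)
have -> : \matrix_(i < n.+1, j < n.+1) mu a b q (k i + j)%N =
    diag_mx c *m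
    \matrix_(i < n.+1, j < n.+1) (mixed_prod n u v j).[- q ^+ k i].
  apply/matrixP => i j; rewrite mul_diag_mx !mxE /mu.
  have evalE m (w : nat -> F) (x y : F) :
      (forall l, w l = y * q ^+ l) ->
      (\prod_(l < m) (1 + w l *: 'X)).[- x] = qpoch (y * x) q m.
    move=> wE; rewrite horner_prod; apply: eq_bigr => l _.
    by rewrite !hornerE wE mulrN mulrAC.
  rewrite hornerM (evalE _ _ _ (a * q)) //.
  rewrite (evalE _ (fun l => v (j + l)%N) _ (a * b * q ^+ 2 * q ^+ j)); last first.
    by move=> l; rewrite /v exprD mulrA.
  have nz1 := nz (k i + j)%N; have nz2 := nz (k i + n)%N.
  have kn : (k i + n = k i + j + (n - j))%N by rewrite -addnA subnKC // -ltnS.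
  (* The tail of length [n - j] is nonzero as a factor of the longer denominator, so it can be
     cancelled. *)
  move: nz2; rewrite kn !(qpochD _ _ (k i + j)%N) mulf_eq0 negb_or.
  case/andP=> _; rewrite (qpochD (a * q)) exprD mulrA [_ * q ^+ k i * _]mulrAC.
  by move=> nz2; field; rewrite nz1 nz2.
rewrite det_mulmx det_diag det_mixed_prod_eval prod_triangle_qpoch.
under eq_bigr => i _ do rewrite mxE.
under [X in _ * (_ * X)]eq_bigr => i _ do
  under eq_bigr => j _ do rewrite opprK addrC.
by ring.
Qed.

(** Each factor is the image of a polynomial taking the value 1 at the origin. *)
Lemma qpoch_ind_neq0 (K : fieldType) (m : nat) :
  qpoch (ind_a K * ind_b K * ind_q K ^+ 2) (ind_q K) m != 0.
Proof.
apply/prodf_neq0 => i _; rewrite /ind_a /ind_b /ind_q.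
rewrite -!(tofracXn, tofracM) -tofrac1 -tofracB tofrac_eq0.
apply/eqP => /(congr1 (meval (fun _ => 0))) /eqP.
by rewrite !(mevalB, mevalM, mevalXU, meval0, meval1, rmorph1) !mul0r subr0 oner_eq0.
Qed.

Theorem theorem1p3 (K : fieldType) (n : nat) (hn : (0 < n)%N)
    (k : 'I_n -> nat) :
  let a := ind_a K in let b := ind_b K in let q := ind_q K in
  \det (\matrix_(i < n, j < n) mu a b q (k i + j)%N) =
    a ^+ 'C(n, 2) * q ^+ 'C(n.+1, 3)
    * (\prod_(i < n) (qpoch (a * q) q (k i)
                      / qpoch (a * b * q ^+ 2) q (k i + n - 1)%N))
    * (\prod_(i < n) \prod_(j < n | (i < j)%N) (q ^+ k i - q ^+ k j))
    * (\prod_(i < n) qpoch (b * q) q i).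
Proof.
case: n hn k => // n _ k a b q.
rewrite det_mu; last exact: qpoch_ind_neq0.
by under [in RHS]eq_bigr => i _ do rewrite addnS subn1.
Qed.
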